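(* Let $(\mathcal X,d)$ be a compact metric space and $F\subset C(\mathcal X,\mathcal X)$. Suppose at least one of the following holds: (1) the semigroup $\langle F\rangle$ is precompact in $(C(\mathcal X,\mathcal X),d_\infty)$; (2a) $\langle F\rangle$ is equicontinuous; (2b) $\langle F\rangle$ is uniformly Lipschitz, i.e. $\sup_{f\in\langle F\rangle}\mathrm{Lip}(f)<\infty$; (2c) the generators are non-expanding, i.e. $\sup_{f\in F}\mathrm{Lip}(f)\le1$. Then the closure $G:=\overline{\langle F\rangle}^{\,d_\infty}\subset C(\mathcal X,\mathcal X)$ is compact and equicontinuous, and for all $\varepsilon>0$ and all $k\ge 0$, $$N\big(B(k,F),d_\infty,\varepsilon\big)\le N\big(G,d_\infty,\varepsilon\big)<\infty .$$
   Context: $C(\mathcal X,\mathcal X)$ is the set of continuous self-maps with $d_\infty(f,g)=\sup_{x}d(f(x),g(x))$. $\mathrm{Lip}(f)$ is the best Lipschitz constant. $B(k,F)$ is the set of all compositions of at most $k$ maps from $F$ (including the identity as the empty composition). $\langle F\rangle$ is the semigroup generated by $F$ under composition, with the convention that it contains the identity, i.e. $\langle F\rangle=\bigcup_{k\ge0}B(k,F)$. $N(A,\rho,\varepsilon)$ is the covering number: the least number of open $\rho$-balls of radius $\varepsilon$ with centers in the ambient metric space covering $A$. *)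

(* Defs.v *)
From HB Require Import structures.
From mathcomp Require Import all_boot all_order all_algebra finmap.
From mathcomp Require Import all_classical all_reals ereal topology normedtype.

Set Implicit Arguments.
Unset Strict Implicit.
Unset Printing Implicit Defensive.

Import Order.TTheory GRing.Theory Num.Theory.
Local Open Scope classical_set_scope.
Local Open Scope ring_scope.

(* [C(X, X)] for a compact metric space [X].  The compactness proof [cX] is
   part of the type because it is what makes the supremum distance finite;
   the balls, the topology, [closure], [compact] and [precompact] on this type
   are those of the metric [dinfty] declared below. *)
Definition selfmap (R : realType) (X : metricType R)
  (cX : compact [set: X]) : Type := continuousType X X.

Section selfmap_metric.
Context (R : realType) (X : metricType R) (cX : compact [set: X]).
Implicit Types f g h : selfmap cX.

Definition selfmap_id : selfmap cX := idfun.

Definition selfmap_comp f g : selfmap cX := f \o g.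

(* On the empty space the supremum is [sup set0 = 0]. *)
Definition dinfty f g : R := sup [set mdist (f x) (g x) | x in [set: X]].

Local Lemma mdist_bounded (x0 : X) : exists M, forall x, mdist x0 x <= M.
Proof.
have /compact_near_coveringP cov := cX.
have [|M [_ MP]] := cov R (pinfty_nbhs R) (fun M x => mdist x0 x <= M) _.
  move=> x _; exists (ball x 1, [set M | mdist x0 x + 1 < M]) => /=.
    split; first exact: nbhsx_ballx.
    by exists (mdist x0 x + 1); split; first exact: num_real.
  case=> y M /= []; rewrite ballEmdist/= => xy xM.
  apply: le_trans (metric_triangle x0 x y) _; apply: le_trans (ltW xM).
  by rewrite lerD2l ltW.
exists (M + 1) => x.
by apply: MP => //; rewrite ltrDl.
Qed.

Local Lemma dinfty_has_ubound f g :
  has_ubound [set mdist (f x) (g x) | x in [set: X]].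
Proof.
have [[x0 _]|X0] := pselect (exists x : X, True); last first.
  by exists 0 => _ [x _ <-]; case: X0; exists x.
have [M MP] := mdist_bounded x0.
exists (M + M) => _ [x _ <-].
apply: le_trans (metric_triangle _ x0 _) _.
by rewrite lerD// metric_sym.
Qed.

Local Lemma le_dinfty f g x : mdist (f x) (g x) <= dinfty f g.
Proof. by apply: ub_le_sup; [exact: dinfty_has_ubound|exists x]. Qed.

Local Lemma dinfty_le f g e :
  0 <= e -> (forall x, mdist (f x) (g x) <= e) -> dinfty f g <= e.
Proof.
move=> e0 fge; rewrite /dinfty; have [->|/set0P S0] :=
  eqVneq [set mdist (f x) (g x) | x in [set: X]] set0; first by rewrite sup0.
by apply: ge_sup => // _ [x _ <-].
Qed.

Local Lemma dinfty_ge0 f g : 0 <= dinfty f g.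
Proof.
rewrite /dinfty; have [->|/set0P[_ [x _ _]]] :=
  eqVneq [set mdist (f x) (g x) | x in [set: X]] set0; first by rewrite sup0.
exact: le_trans (mdist_ge0 _ _) (le_dinfty f g x).
Qed.

Local Lemma dinftyxx f : dinfty f f = 0.
Proof.
apply/eqP; rewrite eq_le dinfty_ge0 andbT; apply: dinfty_le => // x.
by rewrite mdistxx.
Qed.

Local Lemma dinfty_positivity f g : dinfty f g = 0 -> f = g.
Proof.
move=> fg0; apply/continuousEP => x; apply: mdist_positivity; apply/eqP.
by rewrite eq_le mdist_ge0 andbT -fg0 le_dinfty.
Qed.

Local Lemma dinfty_sym f g : dinfty f g = dinfty g f.
Proof.
rewrite /dinfty; congr (sup _); apply/seteqP; split => _ [x _ <-];
by exists x => //; rewrite metric_sym.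
Qed.

Local Lemma dinfty_triangle g f h : dinfty f h <= dinfty f g + dinfty g h.
Proof.
apply: dinfty_le => [|x]; first by rewrite addr_ge0 ?dinfty_ge0.
by apply: le_trans (metric_triangle _ (g x) _) _; rewrite lerD ?le_dinfty.
Qed.

HB.instance Definition _ := Choice.copy (selfmap cX) (continuousType X X).

HB.instance Definition _ := isMetric.Build R (selfmap cX)
  dinftyxx dinfty_positivity dinfty_sym dinfty_triangle.

(* [B(k, F)]; the empty word gives the identity. *)
Definition word_ball (k : nat) (F : set (selfmap cX)) : set (selfmap cX) :=
  [set f | exists s : seq (selfmap cX),
    [/\ (size s <= k)%N, (forall g, g \in s -> F g)
      & f = foldr selfmap_comp selfmap_id s]].

Definition semigroup (F : set (selfmap cX)) : set (selfmap cX) :=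
  \bigcup_k word_ball k F.

(* Equicontinuity with a modulus uniform in the point.  The library's
   [equicontinuous] is only available for a pointed codomain, which would
   exclude the empty space. *)
Definition unif_equicontinuous (W : set (selfmap cX)) : Prop :=
  forall e : R, 0 < e -> exists2 delta : R, 0 < delta &
    forall f, W f -> forall x y : X, mdist x y < delta -> mdist (f x) (f y) < e.

End selfmap_metric.

(* The best Lipschitz constant; [+oo] when [f] is not Lipschitz. *)
Definition Lip (R : realType) (X Y : metricType R) (f : X -> Y) : \bar R :=
  ereal_inf [set L%:E | L in
    [set L : R | 0 <= L /\ forall x y, mdist (f x) (f y) <= L * mdist x y]].

(* The least cardinality of a finite set of centers in [M] whose open [e]-balls
   cover [A] (an infimum of natural numbers, hence attained if some finite
   cover exists); [+oo] when there is none. *)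
Definition covering_number (R : realType) (M : metricType R) (A : set M)
    (e : R) : \bar R :=
  ereal_inf [set (#|` s|%:R)%:E | s in
    [set s : {fset M} | A `<=` \bigcup_(c in [set` s]) ball c e]].

(* Main.v *)
(** Everything reduces to uniform equicontinuity of the semigroup: a precompact
    set of maps of a compact space is equicontinuous, a uniform Lipschitz bound
    gives a modulus at once, and compositions of non-expanding maps are
    non-expanding.  Equicontinuity gives compactness of the closure [G] as in
    Arzelà-Ascoli: an ultrafilter on [G] converges pointwise by compactness of
    [X], the pointwise limit inherits the modulus, and a finite net of [X]
    upgrades the convergence to a uniform one.  Covering numbers are monotone
    and those of compact sets are finite. *)

Require Import Defs.
From mathcomp Require Import all_boot all_order all_algebra.
From mathcomp Require Import finmap lra.
From mathcomp Require Import all_classical all_reals ereal topology normedtype.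

Import Order.TTheory GRing.Theory Num.Theory.
Import metricType_numDomainType.

Local Open Scope classical_set_scope.
Local Open Scope ring_scope.

Lemma fmap_ultra {T U : Type} (f : T -> U) (F : set_system T) :
  UltraFilter F -> UltraFilter (f @ F).
Proof.
move=> FU; split=> [|G GF FG]; first exact: fmap_proper_filter.
apply/seteqP; split=> A; last exact: FG.
move=> GA; have [//|FnA] := in_ultra_setVsetC (f @^-1` A) FU.
have [? []//] : A `&` ~` A !=set0.
by apply: (@filter_ex _ G); apply: filterI => //; exact: FG.
Qed.

Section covering.
Context {R : realType} {M : metricType R}.
Implicit Types A B : set M.

Lemma le_covering_number A B (e : R) : A `<=` B ->
  (covering_number A e <= covering_number B e)%E.
Proof.
move=> AB; apply: ereal_inf_le_tmp => _ [s Bs <-].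
by exists s => //; exact: subset_trans Bs.
Qed.

(* Near-covering along the filter of finite sets of centers directed by
   inclusion avoids [compact_cover], which needs a pointed type. *)
Lemma compact_covering_number_lty A (e : R) : compact A -> 0 < e ->
  (covering_number A e < +oo)%E.
Proof.
move=> /compact_near_coveringP cA e0.
pose above := filter_from [set: {fset M}]
  (fun s => [set t : {fset M} | (s `<=` t)%fset]).
have above_filter : Filter above.
  apply: filter_from_filter; first by exists fset0.
  move=> s t _ _; exists (s `|` t)%fset => // u /= stu.
  by split; apply: fsubset_trans stu; rewrite ?fsubsetUl ?fsubsetUr.
have [|s _ /(_ s (fsubset_refl s)) sA] :=
    cA _ above (fun s x => exists2 c, c \in s & ball c e x) above_filter.
  move=> x Ax; exists (ball x e, [set t : {fset M} | ([fset x] `<=` t)%fset]).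
    by split=> /=; [exact: nbhsx_ballx|exists [fset x]%fset].
  by case=> y t /= [xy xt]; exists x => //; rewrite -fsub1set.
apply: (@le_lt_trans _ _ (#|` s|%:R)%:E); last exact: ltry.
by apply: ereal_inf_lbound; exists s.
Qed.

End covering.

(** A violation at [x], [y] forces [x <> y] and a difference quotient above [Lip f]; some admissible
    constant then lies below that quotient, which is absurd. *)
Lemma Lip_le_mdist (R : realType) (X Y : metricType R) (f : X -> Y) (L : R) :
  (Lip f <= L%:E)%E -> forall x y, mdist (f x) (f y) <= L * mdist x y.
Proof.
move=> fL x y; rewrite leNgt; apply/negP => Lfxy.
have xy0 : 0 < mdist x y.
  rewrite mdist_gt0; apply/eqP => xy.
  by move: Lfxy; rewrite xy !mdistxx mulr0 ltxx.
have : (Lip f < (mdist (f x) (f y) / mdist x y)%:E)%E.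
  by apply: le_lt_trans fL _; rewrite lte_fin ltr_pdivlMr.
case/ereal_inf_lt => _ [L' [_ fL'] <-].
by rewrite lte_fin ltr_pdivlMr// ltNge fL'.
Qed.

Section selfmaps.
Context {R : realType} {X : metricType R} {cX : compact [set: X]}.
Implicit Types (f g : selfmap cX) (W F : set (selfmap cX)).

Lemma mdist_le_selfmap f g x : mdist (f x) (g x) <= mdist f g.
Proof. exact: Defs.le_dinfty. Qed.

Lemma selfmap_continuous f : continuous (f : X -> X).
Proof. exact: cts_fun. Qed.

(** Heine-Cantor, by near-covering along radii tending to [0] from the right. *)
Lemma selfmap_unif_continuous f (e : R) : 0 < e ->
  exists2 delta : R, 0 < delta &
    forall x y : X, mdist x y < delta -> mdist (f x) (f y) < e.
Proof.
move=> e0; have /compact_near_coveringP cov := cX.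
have /(filterI (nbhs_right_gt 0))/filter_ex[d [d0 dP]] : \forall d \near 0^'+,
    [set: X] `<=` [set x | forall y, mdist x y < d -> mdist (f x) (f y) < e].
  apply: cov => x _.
  have /nbhs_mdistP[d /= d0 fd] : \forall y \near x, mdist (f x) (f y) < e / 2.
    by apply: (cvgr_dist_lt (selfmap_continuous f x)); rewrite divr_gt0.
  have d20 : 0 < d / 2 by rewrite divr_gt0.
  (* Halving keeps both [y] and any [z] within [r] of [y] inside the [d]-ball at [x]. *)
  exists (ball x (d / 2), [set r | r < d / 2]).
    by split=> /=; [exact: nbhsx_ballx|exact: nbhs_right_lt].
  case=> y r /= []; rewrite ballEmdist/= => xy rd z yz.
  rewrite (splitr e); apply: le_lt_trans (metric_triangle _ (f x) _) _.
  rewrite ltrD//; last first.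
    apply: fd; rewrite /= (splitr d).
    apply: le_lt_trans (metric_triangle _ y _) _.
    by rewrite ltrD// (lt_trans yz).
  rewrite metric_sym; apply: fd; rewrite /= (lt_trans xy)//.
  by rewrite ltr_pdivrMr// ltr_pMr// ltr1n.
by exists d => // x; exact: dP.
Qed.

(** A modulus of [f] for [e / 3] serves for [e] on the whole ball of radius [e / 3] around [f];
    near-covering of [W] makes it common. *)
Lemma compact_unif_equicontinuous W : compact W -> unif_equicontinuous W.
Proof.
move=> /compact_near_coveringP cov e e0.
have e30 : 0 < e / 3 by rewrite divr_gt0.
have /(filterI (nbhs_right_gt 0))/filter_ex[d [d0 dP]] : \forall d \near 0^'+,
    W `<=` [set f : selfmap cX |
      forall x y : X, mdist x y < d -> mdist (f x) (f y) < e].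
  apply: cov => f Wf; have [d d0 fd] := selfmap_unif_continuous f _ e30.
  exists (ball f (e / 3), [set r | r < d]).
    by split=> /=; [exact: nbhsx_ballx|exact: nbhs_right_lt].
  case=> g r /= []; rewrite ballEmdist/= => fg rd x y xy.
  have -> : e = e / 3 + e / 3 + e / 3 by lra.
  apply: le_lt_trans (metric_triangle _ (f y) _) _.
  rewrite ltrD//; last exact: le_lt_trans (mdist_le_selfmap _ _ _) fg.
  apply: le_lt_trans (metric_triangle _ (f x) _) _.
  rewrite ltrD//; last exact/fd/(lt_trans xy).
  by rewrite metric_sym; exact: le_lt_trans (mdist_le_selfmap _ _ _) fg.
by exists d.
Qed.

Lemma sub_unif_equicontinuous V W : V `<=` W ->
  unif_equicontinuous W -> unif_equicontinuous V.
Proof.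
by move=> VW eW e /eW[d d0 dP]; exists d => // f /VW; exact: dP.
Qed.

Lemma closure_unif_equicontinuous W :
  unif_equicontinuous W -> unif_equicontinuous (closure W).
Proof.
move=> eW e e0; have e30 : 0 < e / 3 by rewrite divr_gt0.
have [d d0 dP] := eW _ e30; exists d => // f clWf x y xy.
have [g [Wg]] := clWf _ (nbhsx_ballx f _ e30).
rewrite ballEmdist/= => fg.
have -> : e = e / 3 + e / 3 + e / 3 by lra.
apply: le_lt_trans (metric_triangle _ (g y) _) _.
rewrite ltrD//; last first.
  by rewrite metric_sym; exact: le_lt_trans (mdist_le_selfmap _ _ _) fg.
apply: le_lt_trans (metric_triangle _ (g x) _) _.
by rewrite ltrD//; [exact: le_lt_trans (mdist_le_selfmap _ _ _) fg|exact: dP].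
Qed.

Lemma unif_equicontinuous_compact W :
  closed W -> unif_equicontinuous W -> compact W.
Proof.
move=> clW eW; rewrite compact_ultra => U UU UW.
(* The candidate limit [g] is pointwise so far; its continuity and the uniform convergence come from
   the modulus. *)
have /choice[g gP] : forall x, exists y : X, (fun f : selfmap cX => f x) @ U --> y.
  move=> x; have := cX; rewrite compact_ultra.
  move=> /(_ ((fun f : selfmap cX => f x) @ U) (fmap_ultra _ _ UU) filterT)[y [_ xy]].
  by exists y.
have g_modulus e : 0 < e -> exists2 d, 0 < d &
    (forall f, W f -> forall x y : X, mdist x y < d -> mdist (f x) (f y) < e) /\
    (forall x y : X, mdist x y < d -> mdist (g x) (g y) <= e).
  move=> e0; have [d d0 dP] := eW _ e0; exists d => //; split=> // x y xy.
  (* With slack [r], a single [f] in [W] approximates [g] within [r / 2] at both points; the strict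
     bound becomes weak in the limit. *)
  apply/ler_addgt0Pr => r r0; have r20 : 0 < r / 2 by rewrite divr_gt0.
  have [f [Wf [fx fy]]] : exists f, W f /\
      (mdist (g x) (f x) < r / 2 /\ mdist (g y) (f y) < r / 2).
    apply: (@filter_ex _ U); apply: filterI => //; apply: filterI.
      exact: (cvgr_dist_lt (gP x)).
    exact: (cvgr_dist_lt (gP y)).
  apply: le_trans (metric_triangle _ (f x) _) _.
  apply: le_trans (lerD (lexx _) (metric_triangle _ (f y) _)) _.
  rewrite (metric_sym (f y)); have := dP f Wf x y xy; lra.
have cg : continuous g.
  move=> x; apply/cvgrPdist_le => e /g_modulus[d d0 [_ gd]].
  by apply/nbhs_mdistP; exists d => // y; exact: gd.
pose G : selfmap cX := [the continuousType X X of mkcts cg].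
suff UG : U --> G.
  by exists G; split=> //; apply: (@closed_cvg _ _ U _ id).
apply/fcvgrPdist_lt => e e0; have e40 : 0 < e / 4 by rewrite divr_gt0.
have [d d0 [fd gd]] := g_modulus _ e40.
have /compact_near_coveringP cov := cX.
(* Going from [g y] through [g x] and [f x] to [f y] costs three quarters of [e]; the fourth keeps
   the bound strict after taking the supremum. *)
have near_G : \forall f \near U, [set: X] `<=`
    [set x | W f -> mdist (g x) (f x) <= 3 * (e / 4)].
  apply: cov => x _.
  exists (ball x d, [set f : selfmap cX | mdist (g x) (f x) < e / 4]).
    by split=> /=; [exact: nbhsx_ballx|exact: (cvgr_dist_lt (gP x))].
  case=> y f /= []; rewrite ballEmdist/= => xy gfx Wf.
  apply: le_trans (metric_triangle _ (g x) _) _.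
  apply: le_trans (lerD (lexx _) (metric_triangle _ (f x) _)) _.
  by have := gd _ _ xy; rewrite metric_sym; have := fd f Wf _ _ xy; lra.
apply: filterS2 UW near_G => f Wf fG.
apply: (@le_lt_trans _ _ (3 * (e / 4))); last by lra.
by apply: Defs.dinfty_le => [|x]; [lra|exact: fG].
Qed.

Lemma lipschitz_unif_equicontinuous W (L : R) :
  (forall f, W f -> forall x y : X, mdist (f x) (f y) <= L * mdist x y) ->
  unif_equicontinuous W.
Proof.
(* The sign of [L] is unknown, so the divisor is the positive majorant [|L| + 1]. *)
move=> WL e e0; have L0 : 0 < `|L| + 1 by rewrite ltr_wpDl.
exists (e / (`|L| + 1)); first by rewrite divr_gt0.
move=> f Wf x y; rewrite ltr_pdivlMr// => xy.
apply: le_lt_trans (WL f Wf x y) (le_lt_trans _ xy).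
by rewrite mulrC ler_wpM2l ?mdist_ge0// (le_trans (ler_norm L))// lerDl.
Qed.

Lemma semigroup_nonexpanding F :
  (forall f, F f -> forall x y : X, mdist (f x) (f y) <= mdist x y) ->
  forall f, semigroup F f -> forall x y : X, mdist (f x) (f y) <= mdist x y.
Proof.
move=> F1 _ [k _ [s [_ sF ->]]].
elim: s sF => [_ x y|g s IH sF x y]; first exact: lexx.
apply: le_trans (F1 g _ _ _) _; first by apply: sF; rewrite mem_head.
by apply: IH => h hs; apply: sF; rewrite inE hs orbT.
Qed.

Lemma word_ball_sub_semigroup k F : word_ball k F `<=` semigroup F.
Proof. by move=> f kf; exists k. Qed.

End selfmaps.

Theorem mainTheorem4 (R : realType) (X : metricType R)
    (cX : compact [set: X]) (F : set (selfmap cX))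
    (hF : [\/ precompact (semigroup F),
              unif_equicontinuous (semigroup F),
              (ereal_sup [set Lip (f : X -> X) | f in semigroup F] < +oo)%E
            | (ereal_sup [set Lip (f : X -> X) | f in F] <= 1)%E]) :
  let G := closure (semigroup F) in
  [/\ compact G,
      unif_equicontinuous G
    & forall (e : R) (k : nat), 0 < e ->
        (covering_number (word_ball k F) e <= covering_number G e)%E /\
        (covering_number G e < +oo)%E].
Proof.
move=> G.
have eF : unif_equicontinuous (semigroup F).
  case: hF => [|//|LF|LF].
  (* Precompactness is compactness of the closure, whose modulus restricts to the semigroup. *)
  - rewrite precompactE => /compact_unif_equicontinuous.
    exact/sub_unif_equicontinuous/subset_closure.
  (* A finite supremum is its own real bound; in the case [-oo], [0] serves. *)
  - have [L FL] : exists L : R,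
        (ereal_sup [set Lip (f : X -> X) | f in semigroup F] <= L%:E)%E.
      case: (ereal_sup _) LF => [L _|//|_]; first by exists L.
      by exists 0; rewrite leNye.
    apply: (@lipschitz_unif_equicontinuous _ _ _ _ L) => f Ff.
    by apply/Lip_le_mdist/(le_trans _ FL)/ereal_sup_ubound; exists f.
  - apply: (@lipschitz_unif_equicontinuous _ _ _ _ 1) => f Ff x y.
    rewrite mul1r; apply: semigroup_nonexpanding Ff _ _ => {x y}f Ff x y.
    rewrite -[leRHS]mul1r; apply: Lip_le_mdist.
    by apply: le_trans LF; apply: ereal_sup_ubound; exists f.
have eG : unif_equicontinuous G by exact: closure_unif_equicontinuous.
have cG : compact G.
  by apply: unif_equicontinuous_compact => //; exact: closed_closure.
split=> // e k e0; split; last exact: compact_covering_number_lty.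
apply: le_covering_number; apply: subset_trans (@subset_closure _ _).
exact: word_ball_sub_semigroup.
Qed.
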